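(* Let $p>1$ be an integer. Then $\tilde{\epsilon}_1(p)=0$ and \[\tau(p/1)\leq \tilde{\epsilon}_2(p)\leq \frac1p-\frac{1}{p^3+p^2}.\]
   Context: For real $x$, $\Vert x\Vert$ denotes the distance from $x$ to the nearest integer. For real $\zeta>1$ and $\epsilon>0$, let $\varpi_{\epsilon,\zeta}$ be the set of all real $\alpha\neq 0$ such that $\Vert\alpha\zeta^n\Vert\leq\epsilon$ for all integers $n\geq n_0$, for some integer $n_0=n_0(\alpha,\zeta,\epsilon)$. Define $\tilde{\epsilon}_1(\zeta):=\sup\{\epsilon>0:\varpi_{\epsilon,\zeta}=\emptyset\}$ and $\tilde{\epsilon}_2(\zeta):=\sup\{\epsilon>0: \varpi_{\epsilon,\zeta}\text{ is at most countable}\}$, with $\sup\emptyset=0$. For real $z$ let $E(z):=\frac{1-(1-z)\prod_{m\geq 0}(1-z^{2^m})}{2z}$, and $\tau(p/1):=E(1/p)/p$. *)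

(* Defs.v *)
From mathcomp Require Import all_boot all_order all_algebra.
From mathcomp Require Import all_classical all_reals all_analysis.
Import Order.TTheory GRing.Theory Num.Theory.
Import numFieldNormedType.Exports.

Set Implicit Arguments.
Unset Strict Implicit.
Unset Printing Implicit Defensive.

Local Open Scope classical_set_scope.
Local Open Scope ring_scope.

(* Distance from x to the nearest integer. *)
Definition dist_int (R : realType) (x : R) : R :=
  inf [set `|x - k%:~R| | k in [set: int]].

Definition varpi (R : realType) (eps zeta : R) : set R :=
  [set alpha | alpha != 0 /\
     exists n0 : int, forall n : int, n0 <= n ->
       dist_int (alpha * zeta ^ n) <= eps].

(* In the two definitions below [sup set0 = 0]. Both sets are bounded above by
   1/2: if 1/2 <= eps, then [varpi eps zeta] is the set of all nonzero reals.
   Hence [sup] never takes its default value on an unbounded set. *)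
Definition eps_tilde1 (R : realType) (zeta : R) : R :=
  sup [set eps | 0 < eps /\ varpi eps zeta = set0].

(* [countable] includes the finite sets. *)
Definition eps_tilde2 (R : realType) (zeta : R) : R :=
  sup [set eps | 0 < eps /\ countable (varpi eps zeta)].

(* The infinite product is the limit of its partial products; it converges for
   |z| < 1, and E is only used at z = 1/p with p > 1. *)
Definition E (R : realType) (z : R) : R :=
  (1 - (1 - z) * limn (fun n : nat => \prod_(0 <= m < n) (1 - z ^+ (2 ^ m))))
    / (2 * z).

(* tau p is the value tau(p/1). *)
Definition tau (R : realType) (p : nat) : R := E (p%:R^-1) / p%:R.

(* Main.v *)
Require Import Defs.
From mathcomp Require Import all_boot all_order all_algebra.
From mathcomp Require Import all_classical all_reals all_analysis.
From mathcomp Require Import ring lra zify.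
Import Order.TTheory GRing.Theory Num.Theory.
Import numFieldNormedType.Exports.

Local Open Scope classical_set_scope.
Local Open Scope ring_scope.

(** For [alpha] in [varpi eps p], write [alpha p^n = k_n + e_n] with [k_n] an
    integer and [|e_n| <= eps], so that [p e_n - e_(n+1)] is an integer.

    Lower bound.  If [eps] is below the claimed upper bound and some
    [|e_j| >= 1/(p+1)], then the same holds at all [j + 2m], and
    [e'_m = ((p+1) e_(j+2m) - sg e_(j+2m)) / (p-1)] is again such an orbit, for
    the base [p^2] and the bound [((p+1) eps - 1) / (p-1)].  If no such [j]
    exists, the orbit vanishes.  Iterating this renormalization, any [eps]
    smaller than some [tau_approx k p] forces [alpha] to be rational, and the
    [tau_approx k p] tend to [tau p].

    Upper bound.  For any sequence of signs [s_m], the orbit with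
    [p e_n - e_(n+1) = b_n - b_(n+1)], where [b] is the image of
    [(1 + s_m)/2] under the substitution [1 -> 10, 0 -> 01], stays below
    [1/p - 1/(p^3 + p^2)].  There are uncountably many of them. *)

(** * Renormalization of orbits with small errors *)

Lemma int_norm_lt2 (R : realType) (s : R) :
  s \is a Num.int -> `|s| < 2 -> [\/ s = -1, s = 0 | s = 1].
Proof.
move=> /intrP[m ->]; rewrite -intr_norm (ltr_int _ _ 2) => m2.
have [->|[->|->]] : m = -1 \/ m = 0 \/ m = 1 by lia.
- exact: Or31.
- exact: Or32.
- exact: Or33.
Qed.

(* The recursion inverts the renormalization [eps |-> ((x+1) eps - 1) / (x-1)],
   which replaces the base [x] by [x^2]. *)
Fixpoint tau_approx (R : realType) (k : nat) (x : R) : R :=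
  if k is k'.+1 then (1 + (x - 1) * tau_approx R k' (x ^+ 2)) / (x + 1) else 0.

Lemma tau_approx_le (R : realType) (k : nat) (x : R) :
  2 <= x -> tau_approx R k x * x <= 1.
Proof.
elim: k x => [|k IH] x x2 /=; first by rewrite mul0r.
have := IH (x ^+ 2) ltac:(nra).
set t := tau_approx _ _ _ => ht.
rewrite mulrAC ler_pdivrMr; last lra.
have : (x - 1) * (t * x ^+ 2 - 1) <= 0 by apply: mulr_ge0_le0; lra.
move=> h; rewrite -subr_ge0 -(pmulr_rge0 _ (_ : 0 < x)); last lra.
nra.
Qed.

(** This is the bound [1/x - 1/(x^3 + x^2)] of the theorem, arranged for [two_step]: when
    [e1 = x * e0 - 1] and [e0 <= eps], the quantity [x * (x * eps - 1)] bounds [x * e1] from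
    above. *)
Lemma tau_approxS_le (R : realType) (k : nat) (x : R) : 2 <= x ->
  x * (x * tau_approx R k.+1 x - 1) <= - (x + 1)^-1.
Proof.
move=> x2 /=.
have := tau_approx_le R k (x ^+ 2) ltac:(nra).
set t := tau_approx _ _ _ => ht.
have -> : x * (x * ((1 + (x - 1) * t) / (x + 1)) - 1) =
    ((x - 1) * (t * x ^+ 2 - 1) - 1) / (x + 1) by field; lra.
rewrite -[leRHS]mulN1r ler_pM2r ?invr_gt0; last lra.
have : (x - 1) * (t * x ^+ 2 - 1) <= 0 by apply: mulr_ge0_le0; lra.
lra.
Qed.

(** With [d = 1/(x+1)] one has [x * d = 1 - d], so [x * e0] lies in [[1 - d, 1)] and the nearby
    integer must be 1. Then [x * e1] lies in [[d - 1, -d]], which leaves 0 or -1 for the next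
    integer and keeps [e2] at distance at least [d] from 0. *)
Lemma two_step_pos (R : realType) (x eps e0 e1 e2 : R) : 2 <= x ->
  x * (x * eps - 1) <= - (x + 1)^-1 ->
  `|e0| <= eps -> `|e1| <= eps -> `|e2| <= eps ->
  x * e0 - e1 \is a Num.int -> x * e1 - e2 \is a Num.int ->
  (x + 1)^-1 <= e0 ->
  x * e0 - e1 = 1 /\
  (e2 <= - (x + 1)^-1 /\ x * e1 - e2 = 0 \/
   (x + 1)^-1 <= e2 /\ x * e1 - e2 = -1).
Proof.
set d := (x + 1)^-1 => x2 heps.
rewrite !ler_norml => /andP[h0 h0'] /andP[h1 h1'] /andP[h2 h2'] i0 i1 de0.
have d0 : 0 < d by rewrite invr_gt0; lra.
have xd : x * d = 1 - d by rewrite /d; field; lra.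
have d3 : d <= 1 / 3 by nra.
have xeps : x * eps < 1 by rewrite -subr_lt0 -(pmulr_rlt0 _ (_ : 0 < x)); lra.
have eps2 : 2 * eps <= x * eps by rewrite ler_wpM2r //; lra.
have X0 : x * d <= x * e0 by rewrite ler_wpM2l //; lra.
have X0' : x * e0 <= x * eps by rewrite ler_wpM2l //; lra.
have s0 : x * e0 - e1 = 1.
  have [|s0|s0|s0 //] := int_norm_lt2 _ _ i0; [|lra..].
  by rewrite ltr_norml; apply/andP; split; lra.
have X1 : x * (- d) <= x * e1 by rewrite ler_wpM2l //; lra.
have X1' : x * e1 <= x * (x * eps - 1) by rewrite ler_wpM2l //; lra.
split=> //.
case: (int_norm_lt2 _ _ i1) => [|s1|s1|s1].
- by rewrite ltr_norml; apply/andP; split; lra.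
- by right; split=> //; lra.
- by left; split=> //; lra.
- lra.
Qed.

Lemma two_step (R : realType) (x eps e0 e1 e2 : R) : 2 <= x ->
  x * (x * eps - 1) <= - (x + 1)^-1 ->
  `|e0| <= eps -> `|e1| <= eps -> `|e2| <= eps ->
  x * e0 - e1 \is a Num.int -> x * e1 - e2 \is a Num.int ->
  (x + 1)^-1 <= `|e0| ->
  [/\ (x + 1)^-1 <= `|e2|, x * e0 - e1 = Num.sg e0 &
      x * e1 - e2 = - (Num.sg e0 + Num.sg e2) / 2].
Proof.
move=> x2 heps h0 h1 h2 i0 i1 d0.
have dp : 0 < (x + 1)^-1 by rewrite invr_gt0; lra.
case: (leP 0 e0) d0 => [e0p|e0n].
  rewrite ger0_norm // => d0.
  have [s0 h] := two_step_pos _ _ _ _ _ _ x2 heps h0 h1 h2 i0 i1 d0.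
  rewrite (gtr0_sg (_ : 0 < e0)); last lra.
  case: h => -[de s1].
  - rewrite ltr0_norm ?ltr0_sg; [|lra..]; split; lra.
  - rewrite gtr0_norm ?gtr0_sg; [|lra..]; split; lra.
rewrite ltr0_norm // => d0.
have j0 : x * - e0 - - e1 \is a Num.int by rewrite mulrN -opprD rpredN.
have j1 : x * - e1 - - e2 \is a Num.int by rewrite mulrN -opprD rpredN.
rewrite -normrN in h0; rewrite -normrN in h1; rewrite -normrN in h2.
have [s0 h] := two_step_pos _ _ _ _ _ _ x2 heps h0 h1 h2 j0 j1 d0.
rewrite (ltr0_sg (_ : e0 < 0)); last lra.
case: h => -[de s1].
- rewrite gtr0_norm ?gtr0_sg; [|lra..]; split; lra.
- rewrite ltr0_norm ?ltr0_sg; [|lra..]; split; lra.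
Qed.

(** Each integer [x * e n - e n.+1] has absolute value below [x/(x+1) + 1/(x+1) = 1], hence
    vanishes. So [e n = x ^+ n * e 0], which is unbounded unless [e 0 = 0]. *)
Lemma small_orbit0 (R : realType) (x : R) (e : nat -> R) : 2 <= x ->
  (forall n, x * e n - e n.+1 \is a Num.int) ->
  (forall n, `|e n| < (x + 1)^-1) -> e 0%N = 0.
Proof.
move=> x2 he hs.
have d0 : 0 < (x + 1)^-1 by rewrite invr_gt0; lra.
have xd : x * (x + 1)^-1 = 1 - (x + 1)^-1 by field; lra.
have step n : e n.+1 = x * e n.
  move: (hs n) (hs n.+1); rewrite !ltr_norml => /andP[a b] /andP[c d].
  have a' : x * - (x + 1)^-1 < x * e n by rewrite ltr_pM2l //; lra.
  have b' : x * e n < x * (x + 1)^-1 by rewrite ltr_pM2l //; lra.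
  have := he n; case/intrP => m hm.
  have : `|m| < 1.
    by rewrite -(ltr_int R) intr_norm -hm ltr_norml; apply/andP; split; lra.
  move=> m1; have m0 : m = 0 by lia.
  by move: hm; rewrite m0; lra.
have eX n : e n = x ^+ n * e 0%N.
  by elim: n => [|n IH]; rewrite ?mul1r // step IH exprS mulrA.
apply/eqP; rewrite -normr_eq0 eq_le normr_ge0 andbT leNgt; apply/negP => e0.
have hn := archi_boundP (_ : 0 <= `|e 0%N|^-1).
rewrite invr_ge0 normr_ge0 in hn; move: (Num.bound _) (hn isT) => {hn} n hn.
have : n%:R <= x ^+ n.
  have : (n%:R : R) <= 2 ^+ n by rewrite -natrX ler_nat ltnW // ltn_expl.
  by move=> h; apply: (le_trans h); rewrite lerXn2r // nnegrE; lra.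
move=> hx; have := hs n; rewrite eX normrM (ger0_norm (exprn_ge0 _ _)); last lra.
apply/negP; rewrite -leNgt.
apply: (@le_trans _ _ 1); first by rewrite invf_le1; lra.
rewrite -(@ler_pdivrMr _ _ _ _ e0) mul1r.
by apply: le_trans hx; exact: ltW.
Qed.

(** Induction on the number of renormalizations, with [p] squared each time. Only some [e n] is
    claimed rational, because the renormalized orbit starts at the first large error found. *)
Lemma orbit_rational (R : realType) (k p : nat) (e : nat -> R) (eps : R) :
  (1 < p)%N -> (forall n, `|e n| <= eps) ->
  (forall n, p%:R * e n - e n.+1 \is a Num.int) ->
  eps < tau_approx R k p%:R -> exists n, range (@ratr R) (e n).
Proof.
elim: k p e eps => [|k IH] p e eps p1 he hint heps.
  (* At depth 0 the threshold is 0, while [eps >= |e 0| >= 0]. *)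
  by have := le_lt_trans (le_trans (normr_ge0 _) (he 0%N)) heps; rewrite ltxx.
have x2 : 2 <= (p%:R : R) by rewrite (ler_nat _ 2).
have [small|] := pselect (forall n, `|e n| < (p%:R + 1)^-1).
  exists 0%N; exists 0 => //.
  by rewrite rmorph0 (small_orbit0 _ _ _ x2 hint small).
move=> /existsNP[j /negP]; rewrite -leNgt => hj.
have hB : p%:R * (p%:R * eps - 1) <= - (p%:R + 1 : R)^-1.
  apply: le_trans (tau_approxS_le R k _ x2).
  rewrite ler_pM2l; last lra.
  by rewrite lerD2r ler_pM2l ?(ltW heps) //; lra.
have big m : (p%:R + 1)^-1 <= `|e (j + m.*2)%N|.
  elim: m => [|m IHm]; first by rewrite addn0.
  rewrite doubleS !addnS.
  by case: (two_step _ _ _ _ _ _ x2 hB (he _) (he _) (he _) (hint _) (hint _) IHm).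
pose f m := e (j + m.*2)%N.
(* This affine map acts on absolute values by sending [1/(p+1)] to 0, and the integer parts for base
   [p^2] become [(sg (f m) - sg (f m.+1)) / 2], one of -1, 0, 1. *)
pose e' m := ((p%:R + 1) * f m - Num.sg (f m)) / (p%:R - 1).
have [m [r _ hr]] : exists m, range (@ratr R) (e' m).
  apply: (IH (p ^ 2)%N e' (((p%:R + 1) * eps - 1) / (p%:R - 1))).
  - by rewrite -[1%N]/(1 ^ 2)%N ltn_exp2r.
  - move=> m; rewrite /e' normrM [X in _ * X]ger0_norm ?invr_ge0; last lra.
    rewrite ler_pM2r ?invr_gt0; last lra.
    have d0 : 0 < (p%:R + 1 : R)^-1 by rewrite invr_gt0; lra.
    have fm : (p%:R + 1)^-1 <= `|f m| := big m.
    have f0 : f m != 0 by rewrite -normr_gt0; lra.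
    have fm1 : 1 <= (p%:R + 1) * `|f m|.
      by rewrite -ler_pdivrMl ?mulr1 //; lra.
    rewrite {1}[f m]numEsg mulrCA -{2}[Num.sg _]mulr1 -mulrBr normrM normr_sg.
    rewrite f0 mul1r ger0_norm; last lra.
    by rewrite lerD2r ler_pM2l ?he //; lra.
  - move=> m.
    have [_ s0 s1] := two_step _ _ _ _ _ _ x2 hB (he (j + m.*2)%N) (he _) (he _)
      (hint _) (hint _) (big m).
    have fS : f m.+1 = e (j + m.*2).+2 by rewrite /f doubleS !addnS.
    rewrite -fS -/(f m) in s0 s1.
    have -> : (p ^ 2)%:R * e' m - e' m.+1 = (Num.sg (f m) - Num.sg (f m.+1)) / 2.
      rewrite /e' natrX.
      have fSE : f m.+1 =
          p%:R * (p%:R * f m - Num.sg (f m)) + (Num.sg (f m) + Num.sg (f m.+1)) / 2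
        by rewrite -s0 subKr; lra.
      move: fSE; move: (Num.sg (f m)) (Num.sg (f m.+1)) => s s' ->.
      by field; rewrite gt_eqF //; lra.
    have sg1 i : Num.sg (f i) = 1 \/ Num.sg (f i) = -1.
      have : f i != 0.
        by rewrite -normr_gt0; apply: lt_le_trans (big i); rewrite invr_gt0; lra.
      by rewrite neq_lt => /orP[/ltr0_sg|/gtr0_sg] ->; [right|left].
    have [-> | ->] := sg1 m; have [-> | ->] := sg1 m.+1.
    + by rewrite subrr mul0r rpred0.
    + by rewrite opprK divff // rpred1.
    + by rewrite -opprD mulNr divff // rpredN1.
    + by rewrite subrr mul0r rpred0.
  - move: heps => /=; set t := tau_approx _ _ _.
    rewrite natrX -/t ltr_pdivlMr; last lra.
    rewrite ltr_pdivrMr; lra.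
(* The renormalization is inverted; its coefficients are rational. *)
exists (j + m.*2)%N.
have : f m = ((p%:R - 1) * e' m + Num.sg (f m)) / (p%:R + 1).
  by rewrite /e'; field; rewrite !gt_eqF //; lra.
rewrite -/(f m) -hr => ->.
exists (((p%:R - 1) * r + (sgz (f m))%:~R) / (p%:R + 1)) => //.
by rewrite fmorph_div !rmorphD rmorphM rmorphB !rmorph1 !rmorph_nat rmorph_int sgrEz.
Qed.

(** * Product formula for the thresholds and their limit *)

(** The recursion becomes multiplicative: [1 - 2 tau_(k+1)(x) = (x-1)/(x+1) * (1 - 2 tau_k(x^2))].
    Squaring [x] shifts the product by one factor, and the last denominator tends to 1. *)
Lemma tau_approxE (R : realType) (k : nat) (x : R) : 1 < x ->
  1 - 2 * tau_approx R k x =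
  (1 - x^-1) * (\prod_(0 <= m < k) (1 - x^-1 ^+ (2 ^ m))) /
    (1 - x^-1 ^+ (2 ^ k)).
Proof.
elim: k x => [|k IH] x x1.
  rewrite big_geq // expn0 expr1 mulr0 subr0 mulr1 divff // subr_eq0 eq_sym.
  by rewrite lt_eqF // invf_lt1 //; lra.
have xx : 1 < x ^+ 2 by rewrite exprn_egt1.
rewrite big_nat_recl // expn0 expr1.
under eq_bigr do rewrite expnS exprM exprVn.
rewrite [in RHS]expnS exprM exprVn.
have -> : 1 - 2 * tau_approx R k.+1 x =
    (x - 1) / (x + 1) * (1 - 2 * tau_approx R k (x ^+ 2)).
  by rewrite /=; field; rewrite gt_eqF //; lra.
rewrite IH // !mulrA; congr (_ * _ / _); field.
by rewrite !gt_eqF //; lra.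
Qed.

Lemma tau_prod_is_cvg (R : realType) (z : R) : 0 <= z <= 1 ->
  cvgn (fun n => \prod_(0 <= m < n) (1 - z ^+ (2 ^ m))) /\
  limn (fun n => \prod_(0 <= m < n) (1 - z ^+ (2 ^ m))) <= 1.
Proof.
move=> /andP[z0 z1]; set u := fun n => _.
have fac m : 0 <= 1 - z ^+ (2 ^ m) <= 1.
  by rewrite subr_ge0 exprn_ile1 //= gerBl exprn_ge0.
have u0 n : 0 <= u n by apply: prodr_ge0 => m _; case/andP: (fac m).
have uS : {homo u : n m / (n <= m)%N >-> m <= n}.
  apply/nonincreasing_seqP => n; rewrite /u big_nat_recr //=.
  by apply: ler_piMr; [exact: u0 | case/andP: (fac n)].
have cu : cvgn u by apply: nonincreasing_is_cvgn => //; exists 0 => _ [n _ <-].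
split=> //; apply: (le_trans (nonincreasing_cvgn_ge uS cu 0)).
by rewrite /u big_geq.
Qed.

Lemma tauE (R : realType) (p : nat) : (1 < p)%N ->
  tau R p = (1 - (1 - p%:R^-1) *
    limn (fun n => \prod_(0 <= m < n) (1 - (p%:R^-1 : R) ^+ (2 ^ m)))) / 2.
Proof.
move=> p1; rewrite /tau /E; set L := limn _; field.
by rewrite pnatr_eq0 -lt0n ltnW.
Qed.

Lemma tau_approx_cvg (R : realType) (p : nat) : (1 < p)%N ->
  tau_approx R k p%:R @[k --> \oo] --> tau R p.
Proof.
move=> p1; have x1 : 1 < (p%:R : R) by rewrite (ltr_nat _ 1).
have z0 : 0 <= (p%:R : R)^-1 by rewrite invr_ge0; lra.
have z1 : (p%:R : R)^-1 < 1 by rewrite invf_lt1; lra.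
have [cu _] := tau_prod_is_cvg R p%:R^-1 ltac:(by rewrite z0 ltW).
rewrite tauE //; set u := fun n => _ in cu *.
have -> : (fun k => tau_approx R k p%:R) =
    (fun k => (1 - (1 - p%:R^-1) * u k / (1 - p%:R^-1 ^+ (2 ^ k))) / 2).
  by apply/funext => k; rewrite -tau_approxE //; field.
have cz : p%:R^-1 ^+ (2 ^ k) @[k --> \oo] --> (0 : R).
  apply: (squeeze_cvgr (f := fun=> 0) (h := fun k => p%:R^-1 ^+ k)).
  - near=> k; rewrite exprn_ge0 //=.
    by apply: ler_wiXn2l => //; [exact: ltW | exact/ltnW/ltn_expl].
  - exact: cvg_cst.
  - by apply: cvg_expr; rewrite ger0_norm.
set L := limn _.
have -> : (1 - (1 - p%:R^-1) * L) / 2 =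
    (1 - (1 - p%:R^-1) * L * (1 - 0)^-1) / 2 :> R by rewrite subr0 invr1 mulr1.
apply: cvgM; last exact: cvg_cst.
apply: cvgB; first exact: cvg_cst.
apply: cvgM; first by apply: cvgM => //; exact: cvg_cst.
apply: cvgV; first by rewrite subr0 oner_eq0.
by apply: cvgB => //; exact: cvg_cst.
Unshelve. all: by end_near. Qed.

Lemma tau_gt0 (R : realType) (p : nat) : (1 < p)%N -> 0 < tau R p.
Proof.
move=> p1; have x1 : 1 < (p%:R : R) by rewrite (ltr_nat _ 1).
have z0 : 0 < (p%:R : R)^-1 by rewrite invr_gt0; lra.
have z1 : (p%:R : R)^-1 < 1 by rewrite invf_lt1; lra.
have [_] := tau_prod_is_cvg R p%:R^-1 ltac:(by rewrite !ltW).
rewrite tauE //; set L := limn _ => L1.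
have : (1 - p%:R^-1) * L <= (1 - p%:R^-1) * 1 by rewrite ler_wpM2l //; lra.
lra.
Qed.

(** * Countability below [tau] *)

Lemma dist_int_le (R : realType) (x : R) (k : int) :
  dist_int x <= `|x - k%:~R|.
Proof. by apply: ge_inf; [exists 0 => _ [j _ <-] | exists k]. Qed.

Lemma dist_int_lt (R : realType) (x eps : R) :
  dist_int x < eps -> exists k : int, `|x - k%:~R| < eps.
Proof.
move=> h.
have [_ [k _ <-] hk] := inf_lt (ex_intro _ _ (ex_intro2 _ _ 0 I erefl)) h.
by exists k.
Qed.

Lemma varpi_countable (R : realType) (p : nat) (eps : R) : (1 < p)%N ->
  eps < tau R p -> countable (varpi eps p%:R).
Proof.
move=> p1 heps.
have [k hk] : exists k, eps < tau_approx R k p%:R.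
  exact: (filter_ex (cvgr_gt _ (tau_approx_cvg R p p1) _ heps)).
suff sub : varpi eps p%:R `<=` range (@ratr R).
  apply: sub_countable (subset_card_le sub) _.
  exact: sub_countable (card_image_le _ _) (countableP _).
move=> a [_ [n0 hn0]].
(* As [dist_int] is an infimum, the integer is chosen with a slightly weaker bound, midway between
   [eps] and the threshold. The absolute value of [n0] makes the exponents natural numbers. *)
have /choice[f hf] : forall n, exists m : int,
    `|a * p%:R ^+ (`|n0| + n) - m%:~R| < (eps + tau_approx R k p%:R) / 2.
  move=> n; apply: dist_int_lt; rewrite exprnP.
  by apply: le_lt_trans (hn0 _ _) _; [lia | lra].
have p0 : (p%:R : R) != 0 by rewrite pnatr_eq0 -lt0n ltnW.
have [n [r _ hr]] : exists n,
    range (@ratr R) (a * p%:R ^+ (`|n0| + n) - (f n)%:~R).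
  apply: (orbit_rational R k p _ ((eps + tau_approx R k p%:R) / 2)) => //.
  - by move=> n; exact: ltW.
  - move=> n; have -> : p%:R * (a * p%:R ^+ (`|n0| + n) - (f n)%:~R) -
        (a * p%:R ^+ (`|n0| + n.+1) - (f n.+1)%:~R) =
        (f n.+1)%:~R - p%:R * (f n)%:~R :> R.
      by rewrite addnS exprS; ring.
    by rewrite rpredB ?rpredM ?rpred_nat ?intr_int.
  - lra.
exists ((r + (f n)%:~R) / p%:R ^+ (`|n0| + n)) => //.
rewrite fmorph_div rmorphD rmorphXn rmorph_nat rmorph_int /= hr subrK mulfK //.
by rewrite expf_neq0.
Qed.

(** * Signed geometric series and the orbits built from them *)

Definition sign_series (R : realType) (q : R) (c : nat -> bool) : R :=
  limn (series (fun k => (-1) ^+ c k * q ^+ k)).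

Lemma normed_sign_series (R : realType) (q : R) (c : nat -> bool) : 0 <= q ->
  [normed series (fun k => (-1) ^+ c k * q ^+ k)] = series (geometric 1 q).
Proof.
move=> q0; apply/funext => n; rewrite /series /=; apply: eq_bigr => k _.
by rewrite normrM normr_sign !mul1r normrX ger0_norm.
Qed.

Lemma sign_series_cvg (R : realType) (q : R) (c : nat -> bool) :
  0 <= q < 1 -> cvgn (series (fun k => (-1) ^+ c k * q ^+ k)).
Proof.
move=> /andP[q0 q1]; apply: normed_cvg; rewrite normed_sign_series //.
by apply: is_cvg_geometric_series; rewrite ger0_norm.
Qed.

Lemma sign_series_norm (R : realType) (q : R) (c : nat -> bool) :
  0 <= q < 1 -> `|sign_series R q c| <= (1 - q)^-1.
Proof.
move=> /andP[q0 q1]; have qn : `|q| < 1 by rewrite ger0_norm.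
apply: (le_trans (lim_series_norm _)); rewrite normed_sign_series //.
  exact: is_cvg_geometric_series.
by rewrite (cvg_lim _ (cvg_geometric_series (a := 1) qn)) ?mul1r.
Qed.

Lemma sign_seriesS (R : realType) (q : R) (c : nat -> bool) : 0 <= q < 1 ->
  sign_series R q c =
  (-1) ^+ c 0%N + q * sign_series R q (fun k => c k.+1).
Proof.
move=> hq; apply: cvg_lim => //; rewrite -cvg_shiftS.
have -> : [sequence series (fun k => (-1) ^+ c k * q ^+ k) n.+1]_n =
    (fun n => (-1) ^+ c 0%N + q * series (fun k => (-1) ^+ c k.+1 * q ^+ k) n).
  apply/funext => n; rewrite /series /= big_nat_recl //= mulr1; congr (_ + _).
  by rewrite mulr_sumr; apply: eq_bigr => k _; rewrite exprS mulrCA.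
apply: cvgD; first exact: cvg_cst.
apply: cvgM; first exact: cvg_cst.
exact: (sign_series_cvg R q (fun k => c k.+1) hq).
Qed.

(** For [q < 1/2] the tail is at most [q/(1-q) < 1], so the sign of the sum reveals the first sign;
    the others follow by peeling off terms. *)
Lemma sign_series_inj (R : realType) (q : R) :
  0 < q < 1 / 2 -> injective (sign_series R q).
Proof.
move=> /andP[q0 q2]; have hq : 0 <= q < 1 by apply/andP; split; lra.
have head (c : nat -> bool) : c 0%N = (sign_series R q c < 0).
  have := sign_series_norm R q (fun k => c k.+1) hq; rewrite (sign_seriesS R q c hq).
  set t := sign_series _ _ _ => ht.
  have : `|q * t| <= q * (1 - q)^-1 by rewrite normrM gtr0_norm // ler_pM2l.
  have : q * (1 - q)^-1 < 1 by rewrite ltr_pdivrMr; lra.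
  move=> h1 /le_lt_trans/(_ h1); rewrite ltr_norml => /andP[h2 h3].
  by case: (c 0%N); rewrite ?expr1 ?expr0; apply/esym; [|apply/negbTE]; lra.
move=> c d cd; apply/funext => n.
elim: n c d cd => [|n IH] c d cd; first by rewrite !head cd.
apply: (IH (fun k => c k.+1) (fun k => d k.+1)).
have c0 : c 0%N = d 0%N by rewrite !head cd.
move: cd; rewrite (sign_seriesS R q c hq) (sign_seriesS R q d hq) c0 => /addrI/mulfI; apply.
by rewrite gt_eqF.
Qed.

(** Cantor's diagonal argument: [d] is built to differ from every [c] at the index [g (f c)], and
    [c = d] gives the contradiction. *)
Lemma uncountable_cantor (T : Type) (A : set T) (f : (nat -> bool) -> T) :
  injective f -> (forall c, A (f c)) -> ~ countable A.
Proof.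
move=> finj fA /countable_injP[g ginj].
pose d n := ~~ `[< exists c, g (f c) = n /\ c n >].
have [dd|dd] := boolP (d (g (f d))).
  by move: (dd); rewrite {1}/d => /asboolPn; apply; exists d.
move: (dd); rewrite {1}/d negbK => /asboolP[c [gc cd]].
have /finj cE : f c = f d by apply: ginj; rewrite ?inE.
by have := congr1 (@^~ (g (f d))) cE; rewrite /= cd (negbTE dd).
Qed.

(* The value [e_(2m)] of the orbit attached to the signs [s_k = (-1)^(c (m+k))];
   the intermediate one is [e_(2m+1) = x e_(2m) - s_0]. *)
Definition doubled_orbit (R : realType) (x : R) (c : nat -> bool) : R :=
  (-1) ^+ c 0%N / 2 - (1 - x^-1) ^+ 2 / 2 * sign_series R (x ^- 2) c.

Lemma exprN2_bounds (R : realType) (x : R) : 2 <= x -> 0 < x ^- 2 <= 1 / 4.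
Proof.
by move=> x2; rewrite invr_gt0 exprn_gt0 ?div1r ?lef_pV2 ?posrE ?exprn_gt0 //; nra.
Qed.

(** After the first sign is factored out, the tail contributes between [-1/(x^2-1)] and [1/(x^2-1)].
    These extremes yield exactly the two bounds: a constant sign gives the lower one, a single
    change right after the first sign the upper one. *)
Lemma doubled_orbit_bounds (R : realType) (x : R) (c : nat -> bool) : 2 <= x ->
  1 / (x + 1) <= (-1) ^+ c 0%N * doubled_orbit R x c <=
  1 / x - 1 / (x ^+ 3 + x ^+ 2).
Proof.
move=> x_ge2; have /andP[q0 q4] := exprN2_bounds R x x_ge2.
have hq : 0 <= x ^- 2 < 1 by apply/andP; split; lra.
rewrite /doubled_orbit (sign_seriesS _ _ _ hq).
set Y := sign_series _ _ _; set s := (-1) ^+ c 0%N.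
have ss : s * s = 1 by rewrite -expr2 sqrr_sign.
have -> : s * (s / 2 - (1 - x^-1) ^+ 2 / 2 * (s + x ^- 2 * Y)) =
    1 / 2 - (1 - x^-1) ^+ 2 / 2 * (1 + x ^- 2 * (s * Y)).
  by ring: ss.
have : `|s * Y| <= (1 - x ^- 2)^-1.
  by rewrite normrM normr_sign mul1r; exact: sign_series_norm.
have x21 : 0 < x ^+ 2 - 1 by nra.
have -> : (1 - x ^- 2)^-1 = x ^+ 2 / (x ^+ 2 - 1).
  by field; rewrite !gt_eqF //; lra.
rewrite ler_norml => /andP[h1 h2].
have qY1 : - (x ^+ 2 - 1)^-1 <= x ^- 2 * (s * Y).
  by rewrite ler_pdivlMl ?exprn_gt0 ?mulrN //; lra.
have qY2 : x ^- 2 * (s * Y) <= (x ^+ 2 - 1)^-1.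
  by rewrite ler_pdivrMl ?exprn_gt0 //; lra.
have a0 : 0 <= (1 - x^-1) ^+ 2 / 2 by rewrite divr_ge0 ?sqr_ge0.
have -> : 1 / (x + 1) =
    1 / 2 - (1 - x^-1) ^+ 2 / 2 * (1 + (x ^+ 2 - 1)^-1).
  by field; rewrite !gt_eqF //; lra.
have -> : 1 / x - 1 / (x ^+ 3 + x ^+ 2) =
    1 / 2 - (1 - x^-1) ^+ 2 / 2 * (1 - (x ^+ 2 - 1)^-1).
  by field; rewrite !gt_eqF //; nra.
by rewrite !lerD2l !lerN2 !ler_wpM2l // lerD2l.
Qed.

Lemma doubled_orbit_step (R : realType) (x : R) (c : nat -> bool) :
  2 <= x -> x \is a Num.int ->
  x ^+ 2 * doubled_orbit R x c - doubled_orbit R x (fun k => c k.+1)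
    \is a Num.int.
Proof.
move=> x_ge2 x_int; have /andP[q0 q4] := exprN2_bounds R x x_ge2.
have hq : 0 <= x ^- 2 < 1 by apply/andP; split; lra.
rewrite /doubled_orbit (sign_seriesS _ _ c hq).
set Y := sign_series _ _ _.
have -> : x ^+ 2 * ((-1) ^+ c 0%N / 2 -
      (1 - x^-1) ^+ 2 / 2 * ((-1) ^+ c 0%N + x ^- 2 * Y)) -
    ((-1) ^+ c 1%N / 2 - (1 - x^-1) ^+ 2 / 2 * Y) =
    (-1) ^+ c 0%N * (x - 1) + ((-1) ^+ c 0%N - (-1) ^+ c 1%N) / 2.
  by field; rewrite gt_eqF //; lra.
rewrite rpredD //; first by rewrite rpredM ?rpred_sign // rpredB // rpred1.
case: (c 0%N); case: (c 1%N); rewrite ?expr1 ?expr0.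
- by rewrite subrr mul0r rpred0.
- by rewrite -opprD mulNr divff // rpredN1.
- by rewrite opprK divff // rpred1.
- by rewrite subrr mul0r rpred0.
Qed.

Lemma doubled_orbit_dist (R : realType) (x : R) (c : nat -> bool) (n : nat) :
  2 <= x -> x \is a Num.int ->
  dist_int (doubled_orbit R x c * x ^+ n) <= 1 / x - 1 / (x ^+ 3 + x ^+ 2).
Proof.
move=> x_ge2 x_int.
have shift m : doubled_orbit R x c * x ^+ m.*2 -
    doubled_orbit R x (fun k => c (m + k)%N) \is a Num.int.
  elim: m => [|m IH]; first by rewrite mulr1 subrr rpred0.
  have := doubled_orbit_step R x (fun k => c (m + k)%N) x_ge2 x_int.
  have -> : (fun k => c (m + k.+1)%N) = (fun k => c (m.+1 + k)%N).
    by apply/funext => k; rewrite addnS.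
  set e' := doubled_orbit _ _ (fun k => c (m.+1 + k)%N).
  set e := doubled_orbit _ _ (fun k => c (m + k)%N) in IH * => he.
  have -> : doubled_orbit R x c * x ^+ (m.+1).*2 - e' =
      x ^+ 2 * (doubled_orbit R x c * x ^+ m.*2 - e) + (x ^+ 2 * e - e').
    by rewrite doubleS !exprS; ring.
  by rewrite rpredD // rpredM // rpredX.
have near (a e : R) : a - e \is a Num.int -> dist_int a <= `|e|.
  by move=> /intrP[k hk]; rewrite -[e](subKr a) hk; exact: dist_int_le.
rewrite -[n]odd_double_half; set m := n./2.
have /= := doubled_orbit_bounds R x (fun k => c (m + k)%N) x_ge2.
rewrite addn0; have := shift m.
set e := doubled_orbit _ _ (fun k => c (m + k)%N); set s := (-1) ^+ c m => he.
have es : `|e| = `|s * e| by rewrite normrM normr_sign mul1r.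
move=> /andP[h1 h2].
have d0 : 0 < 1 / (x + 1) by rewrite divr_gt0 //; lra.
case: (odd n); last first.
  by rewrite add0n; apply: le_trans (near _ _ he) _; rewrite es ger0_norm //; lra.
(* Odd exponents: the error is [x * e - s]. Since [s * e] is at least [1/(x+1)], its absolute value
   is at most [1/(x+1)], again within the bound. *)
have he' : doubled_orbit R x c * x ^+ (1 + m.*2) - (x * e - s) \is a Num.int.
  have -> : doubled_orbit R x c * x ^+ (1 + m.*2) - (x * e - s) =
    x * (doubled_orbit R x c * x ^+ m.*2 - e) + s by rewrite exprS; ring.
  by rewrite rpredD ?rpredM ?rpred_sign.
apply: le_trans (near _ _ he') _.
have -> : `|x * e - s| = `|x * (s * e) - 1|.
  have -> : x * e - s = s * (x * (s * e) - 1).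
    by have ss : s * s = 1 by [rewrite -expr2 sqrr_sign]; ring: ss.
  by rewrite normrM normr_sign mul1r.
have hx1 : x * (1 / (x + 1)) <= x * (s * e) by rewrite ler_wpM2l //; lra.
have hx2 : x * (s * e) <= x * (1 / x - 1 / (x ^+ 3 + x ^+ 2)).
  by rewrite ler_wpM2l //; lra.
have x1 : x * (1 / (x + 1)) = 1 - 1 / (x + 1) by field; rewrite gt_eqF //; lra.
have x2 : x * (1 / x - 1 / (x ^+ 3 + x ^+ 2)) = 1 - 1 / (x * (x + 1)).
  by field; rewrite !gt_eqF //; nra.
have x3 : 0 < 1 / (x * (x + 1)) by rewrite divr_gt0 // mulr_gt0 //; lra.
rewrite ler_norml; apply/andP; split; lra.
Qed.

Lemma doubled_orbit_inj (R : realType) (x : R) (c d : nat -> bool) :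
  2 <= x -> c 0%N = d 0%N -> doubled_orbit R x c = doubled_orbit R x d -> c = d.
Proof.
move=> x2 c0; rewrite /doubled_orbit c0 => /addrI/oppr_inj.
have z : x^-1 < 1 by rewrite invf_lt1; lra.
move=> /mulfI; rewrite mulf_neq0 ?expf_neq0 ?subr_eq0 ?gt_eqF //.
move=> /(_ isT); apply: sign_series_inj.
by have /andP[q0 q4] := exprN2_bounds R x x2; apply/andP; split; lra.
Qed.

(** * Uncountability from the upper bound on, and the theorem *)

Lemma varpi_uncountable (R : realType) (p : nat) (eps : R) : (1 < p)%N ->
  1 / p%:R - 1 / (p%:R ^+ 3 + p%:R ^+ 2) <= eps ->
  ~ countable (varpi eps p%:R).
Proof.
move=> p1 heps.
have x2 : 2 <= (p%:R : R) by rewrite (ler_nat _ 2).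
(* Fixing the first sign makes the orbit value positive, hence nonzero, and supplies the hypothesis
   of [doubled_orbit_inj]. *)
pose cons0 (c : nat -> bool) k := if k is k'.+1 then c k' else false.
apply: (@uncountable_cantor _ _ (fun c => doubled_orbit R p%:R (cons0 c))).
  move=> c d /(doubled_orbit_inj R _ (cons0 c) (cons0 d) x2 erefl) cd.
  by apply/funext => k; have := congr1 (@^~ k.+1) cd.
move=> c; split.
  have /andP[h _] := doubled_orbit_bounds R _ (cons0 c) x2.
  rewrite gt_eqF //; rewrite /= !mul1r in h.
  by apply: lt_le_trans h; rewrite invr_gt0 ltr_wpDl.
exists 0 => -[n _|//]; rewrite -exprnP.
by apply: le_trans heps; apply: doubled_orbit_dist => //; exact: rpred_nat.
Qed.

Theorem theorem2p8 (R : realType) (p : nat) (hp : (1 < p)%N) :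
  eps_tilde1 (p%:R : R) = 0 /\
  tau R p <= eps_tilde2 (p%:R : R) /\
  eps_tilde2 (p%:R : R) <= 1 / p%:R - 1 / (p%:R ^+ 3 + p%:R ^+ 2).
Proof.
pose B : R := 1 / p%:R - 1 / (p%:R ^+ 3 + p%:R ^+ 2).
have ubB : ubound [set eps : R | 0 < eps /\ countable (varpi eps p%:R)] B.
  move=> eps [_ ceps]; rewrite leNgt; apply/negP => /ltW.
  by move=> /(varpi_uncountable R p eps hp).
split; [|split].
- rewrite /eps_tilde1 [X in sup X](_ : _ = set0) ?sup0 //.
  apply/seteqP; split=> // eps [eps0 /seteqP[sub _]].
  (* The number 1 lies in every [varpi eps p], since its multiples by [p ^ n] with [n >= 0] are
     integers. *)
  apply: (sub 1); split; first exact: oner_neq0.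
  exists 0 => -[n _|//]; rewrite mul1r -exprnP.
  apply: le_trans (dist_int_le R _ ((p ^ n)%N%:Z)) _.
  by rewrite -pmulrn natrX subrr normr0 ltW.
- rewrite leNgt; apply/negP => hlt.
  have t0 := tau_gt0 R p hp.
  (* The maximum with 0 ensures that the midpoint of [m] and [tau R p] is a positive [eps], so that
     it belongs to the set under the supremum. *)
  pose m := Num.max 0 (eps_tilde2 (p%:R : R)).
  have m0 : 0 <= m by rewrite le_max lexx.
  have ms : eps_tilde2 (p%:R : R) <= m by rewrite le_max lexx orbT.
  have mt : m < tau R p by rewrite gt_max t0.
  have : (m + tau R p) / 2 <= eps_tilde2 (p%:R : R).
    apply: ub_le_sup; first by exists B.
    by split; [lra | apply: varpi_countable => //; lra].
  lra.
- have [ne|/set0P/negP/negPn/eqP e0] :=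
    pselect ([set eps : R | 0 < eps /\ countable (varpi eps p%:R)] !=set0).
    exact: ge_sup.
  (* The supremum of the empty set is 0, so the bound must be nonnegative; the two-sided estimate
     for any one doubled orbit shows it. *)
  rewrite /eps_tilde2 e0 sup0.
  have /andP[h1 h2] := doubled_orbit_bounds R p%:R xpred0 ltac:(by rewrite (ler_nat _ 2)).
  by apply: le_trans h2; apply: le_trans h1; rewrite divr_ge0 // addr_ge0.
Qed.
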